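(* Let $m\ge1$ and $m+2\le n\le 2m+2$. Every raywise lift of $Y_{m,n}$ (with weights $\alpha_1,\dots,\alpha_n,\beta_1,\dots,\beta_{2m+2}\in\mathbb Z_{\ge0}$ and total weight $W=\sum_i\alpha_i+\sum_j\beta_j$) that is a Fano variety satisfies $$W\ge n-1.$$ Equality holds for a Fano raywise lift exactly in the following case, up to permuting the first $n$ indices (simultaneously in $x_i$, $y_i$ and their weights, $1\le i\le n$): there is a subset $T\subset\{2,\dots,n\}$ with $|T|=m-1$ such that, with $S=\{2,\dots,n\}\setminus T$ (so $|S|=n-m$), the lift is obtained by applying $H(x_i,2)$ for $i\in T$ and $H(y_j,2)$ for $j\in S$ and leaving all other rays unchanged (that is, $\beta_i=1$ for $i\in T$, $\alpha_j=1$ for $j\in S$, and all other weights are $0$). The resulting variety, denoted $\widehat Y_{m,n}$, is a smooth toric Fano variety of dimension $$\dim\widehat Y_{m,n}=2m+n.$$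
   Context: All toric varieties are over an algebraically closed field. A primitive collection of a smooth complete fan is a set of primitive ray generators that does not span a cone although every proper subset does; a set of ray generators spans a cone iff it contains no primitive collection. The model $Y_{m,n}$. Let $m\ge1$, $m+1\le n\le 2m+2$, $N\simeq\mathbb Z^{2m+1}$, and $x_1,\dots,x_{2m+2}\in N$ with $x_1,\dots,x_{2m+1}$ a basis and $x_1+\cdots+x_{2m+2}=0$; put $y_i=-x_i$ ($1\le i\le n$). $Y_{m,n}$ is the smooth projective toric weak Fano $(2m+1)$-fold whose fan has primitive ray generators $x_1,\dots,x_{2m+2},y_1,\dots,y_n$ and whose primitive collections are exactly $\{x_i,y_i\}$ ($1\le i\le n$); $\{x_j\mid j\in\{1,\dots,2m+2\}\setminus I\}$ for $I\subset\{1,\dots,n\}$, $|I|=m$; and $\{y_j\mid j\in J\}$ for $J\subset\{1,\dots,n\}$, $|J|=m+1$. The construction $H(x,p)$. Let $X=X_\Sigma$ be a smooth projective toric variety with lattice $N$, $x$ a primitive ray generator of $\Sigma$ and $p\ge2$. In $\widehat N=N\oplus\mathbb Z^{p-1}$ let $z_1,\dots,z_{p-1}$ be the standard basis of the second summand and $z_p:=x-z_1-\cdots-z_{p-1}$. $H(x,p)(X)$ is the smooth projective toric variety of dimension $\dim X+p-1$ whose fan in $\widehat N$ has as primitive ray generators those of $\Sigma$ with $x$ replaced by $z_1,\dots,z_p$, and as primitive collections exactly the primitive collections $P$ of $\Sigma$ with $x\notin P$, together with $(P\setminus\{x\})\cup\{z_1,\dots,z_p\}$ for the primitive collections $P\ni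 x$. Raywise lifts. Assign weights $\alpha_i\in\mathbb Z_{\ge0}$ to $y_i$ ($1\le i\le n$) and $\beta_j\in\mathbb Z_{\ge0}$ to $x_j$ ($1\le j\le 2m+2$). For each positive weight apply $H(y_i,\alpha_i+1)$, resp. $H(x_j,\beta_j+1)$, to that original ray (never to newly created rays); the result does not depend on the order up to toric isomorphism. The resulting variety is called a raywise lift of $Y_{m,n}$; it has dimension $2m+1+W$ with $W=\sum_{i=1}^n\alpha_i+\sum_{j=1}^{2m+2}\beta_j$. *)

(* Defs.v *)
From HB Require Import structures.
From mathcomp Require Import all_boot all_order all_algebra.
From mathcomp Require Import reals.

Set Implicit Arguments.
Unset Strict Implicit.
Unset Printing Implicit Defensive.

Import Order.TTheory GRing.Theory Num.Theory.

Local Open Scope ring_scope.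

(* A toric variety is given by its fan in N = Z^fdim. A cone is recorded as
   the set of (labels of) the ray generators spanning it; M = Hom(N, Z) is the
   space of integer column vectors. The record carries data only: the axioms
   are collected in [smooth_complete_fan]. *)
Record fan := Fan {
  fdim : nat;
  ray : finType;
  gen : ray -> 'rV[int]_fdim;
  cones : {set {set ray}}
}.

Definition primitive_collections (F : fan) : {set {set ray F}} :=
  [set P | (P \notin cones F)
           && [forall Q : {set ray F}, (Q \proper P) ==> (Q \in cones F)]].

(* The fan in which a set of rays spans a cone iff it contains no member
   of PC. *)
Definition fan_of_collections (d : nat) (T : finType) (g : T -> 'rV[int]_d)
    (PC : {set {set T}}) : fan :=
  @Fan d T g [set s : {set T} | [forall P in PC, ~~ (P \subset s)]].

(* v lies in the closed convex cone of N_R spanned by the generators in s *)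
Definition in_cone (R : realType) (F : fan) (s : {set ray F})
    (v : 'rV[R]_(fdim F)) : Prop :=
  exists2 c : ray F -> R, (forall r, 0 <= c r)
    & v = \sum_(r in s) c r *: map_mx intr (gen r).

Record smooth_complete_fan (R : realType) (F : fan) : Prop := {
  fan_ray : forall r : ray F, [set r] \in cones F;
  fan_face : forall s t : {set ray F},
    s \in cones F -> t \subset s -> t \in cones F;
  fan_inter : forall s t : {set ray F}, s \in cones F -> t \in cones F ->
    forall v : 'rV[R]_(fdim F),
      in_cone s v -> in_cone t v -> in_cone (s :&: t) v;
  fan_complete : forall v : 'rV[R]_(fdim F),
    exists2 s, s \in cones F & in_cone s v;
  (* the generators of each cone are distinct members of a Z-basis of N *)
  fan_smooth : forall s : {set ray F}, s \in cones F ->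
    exists (B : 'M[int]_(fdim F)) (f : ray F -> 'I_(fdim F)),
      [/\ B \in unitmx, {in s &, injective f}
        & forall r, r \in s -> gen r = row (f r) B]
}.

(* Ampleness of the torus-invariant divisor \sum_r a r *: D_r on a smooth
   complete toric variety, i.e. strict convexity of its support function:
   its Cartier data m_s (s a maximal cone) satisfy <m_s, u_r> = - a r for the
   generators u_r of s and <m_s, u_r> > - a r for all the others. *)
Definition ample (F : fan) (a : ray F -> int) : Prop :=
  forall s : {set ray F}, maxset [pred t | t \in cones F] s ->
  exists mu : 'cV[int]_(fdim F), forall r : ray F,
    if r \in s then (gen r *m mu) 0 0 = - a r else - a r < (gen r *m mu) 0 0.

(* - K_X is the sum of all torus-invariant prime divisors. *)
Definition anticanonical (F : fan) : ray F -> int := fun _ => 1.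

Definition Fano (F : fan) : Prop := ample (anticanonical (F := F)).

(* H(x, p), for p >= 2. The label [inl x], freed by the removal of x, is
   reused for z_p = x - z_1 - ... - z_(p-1); [inr k] is z_(k+1) for k < p - 1
   and [inl r] is r for r != x. *)
Section BundleLift.
Variables (F : fan) (x : ray F) (p : nat).

Definition lift_gen (r : ray F + 'I_p.-1) : 'rV[int]_(fdim F + p.-1) :=
  match r with
  | inl r => row_mx (gen r) (if r == x then const_mx (-1) else 0)
  | inr k => row_mx 0 (delta_mx 0 k)
  end.

Definition lift_collection (P : {set ray F}) : {set ray F + 'I_p.-1} :=
  inl @: P :|: (if x \in P then inr @: [set: 'I_p.-1] else set0).

Definition bundle_lift : fan :=
  fan_of_collections lift_gen
    [set lift_collection P | P in primitive_collections F].

End BundleLift.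

(* Apply H(t, w t + 1) successively to the rays t in s; [emb t] is the label
   of the ray t in the current fan. *)
Fixpoint lift_along (T : Type) (w : T -> nat) (F : fan) (emb : T -> ray F)
    (s : seq T) : fan :=
  if s is t :: s' then
    lift_along w (F := bundle_lift (emb t) (w t).+1)
      (fun u => inl (emb u)) s'
  else F.

(* X is obtained from F by lifting, in some order, each of the rays of F of
   positive weight exactly once. *)
Definition raywise_lift (F : fan) (w : ray F -> nat) (X : fan) : Prop :=
  exists s : seq (ray F), [/\ uniq s, s =i [pred r | (0 < w r)%N]
                            & X = lift_along w (F := F) id s].

(* Indices are shifted: the ordinal i stands for the index i + 1. *)
Section Model.
Variables (m n : nat) (le_n : (n <= m.*2.+2)%N).

(* {1, ..., n} as a subset of {1, ..., 2m+2} *)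
Definition widx (i : 'I_n) : 'I_m.*2.+2 := widen_ord le_n i.

Definition xgen (j : 'I_m.*2.+2) : 'rV[int]_m.*2.+1 :=
  if unlift ord_max j is Some k then delta_mx 0 k else const_mx (-1).

(* [inl j] is x_j and [inr i] is y_i. *)
Definition Ygen (r : 'I_m.*2.+2 + 'I_n) : 'rV[int]_m.*2.+1 :=
  match r with inl j => xgen j | inr i => - xgen (widx i) end.

Definition Ycollections : {set {set 'I_m.*2.+2 + 'I_n}} :=
  [set [set inl (widx i); inr i] | i : 'I_n]
  :|: [set inl @: (~: (widx @: I)) | I : {set 'I_n} & #|I| == m]
  :|: [set inr @: J | J : {set 'I_n} & #|J| == m.+1].

Definition Ymn : fan := fan_of_collections Ygen Ycollections.

Definition Yweight (alpha : 'I_n -> nat) (beta : 'I_m.*2.+2 -> nat)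
    (r : ray Ymn) : nat :=
  match r with inl j => beta j | inr i => alpha i end.

(* {2, ..., n} *)
Definition tail_indices : {set 'I_n} := [set i : 'I_n | val i != 0%N].

(* The weights of \hat Y_{m,n} attached to T, with S = {2, ..., n} \ T *)
Definition hat_alpha (T : {set 'I_n}) (i : 'I_n) : nat :=
  i \in tail_indices :\: T.

Definition hat_beta (T : {set 'I_n}) (j : 'I_m.*2.+2) : nat :=
  j \in widx @: T.

End Model.

(* Main.v *)
Require Import Defs.
From mathcomp Require Import all_boot all_order all_algebra perm.
From mathcomp Require Import reals.
From mathcomp Require Import zify lra.

Set Implicit Arguments.
Unset Strict Implicit.
Unset Printing Implicit Defensive.

Import Order.TTheory GRing.Theory Num.Theory.

(** Everything rests on two observations about the lift [H(x, p)] of a fan [F].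

    Send [z_1, ..., z_p] to [x] and every other ray of the lift to itself. A set
    of rays of the lift spans a cone iff the rays of [F] whose whole fiber it
    contains span a cone of [F]; and the linear relations among the generators
    of the lift are exactly those of [F], pulled back along this map, because
    [z_1 + ... + z_p = x]. Hence:
    - a divisor on the lift is ample iff the divisor on [F] obtained by summing
      its coefficients over the fibers is ample ([ample_lift]); after all the
      lifts, the anticanonical divisor becomes the divisor with coefficient
      [1 + w r] at each ray [r] of the original fan ([Fano_lift_along]);
    - being a smooth complete fan passes to the lift. Completeness together with
      the intersection axiom says that every vector has exactly one
      nonnegative expression supported on a cone, and such expressions
      correspond by replacing the coefficients on a fiber by their minimum
      ([cone_coordinates_lift]).

    On the model, linear forms are the integer functions of sum zero on the
    indices [1, ..., 2m+2]. A maximal cone leaves out exactly one index, so that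
    ampleness of the divisor with coefficients [1 + w r] amounts to the
    positivity of the degrees of the primitive relations
    [sum_(j notin I) x_j = sum_(i in I) y_i], [|I| = m], and
    [sum_(j in J) y_j = sum_(j notin J) x_j], [|J| = m+1]
    ([ample_degrees], [degrees_ample]).

    With [g_i = alpha_i + beta_i] for [i <= n] and [b = sum_j beta_j], these
    conditions read [g(I) <= 1 + b < 1 + g(J)] for all [|I| = m], [|J| = m+1].
    If no [g_i] vanishes, then [W >= n]. If [g_i0 = 0], then taking
    [J = I + i0] shows that [g(I) = 1 + b] for every [I] avoiding [i0];
    exchanging one element of [I], for which [n >= m+2] leaves room, shows that
    the other [g_i] are all equal to some [e] with [m e = 1 + b]. So [e >= 1]
    and [W >= (n-1) e >= n-1], and equality forces [e = 1], [b = m-1] and no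
    weight beyond the first [n] indices. *)

(** * Cones of a lift *)

Definition face_closed (F : fan) : Prop :=
  forall s t : {set ray F}, s \in cones F -> t \subset s -> t \in cones F.

Lemma face_closed_collections d (T : finType) (g : T -> 'rV[int]_d)
  (PC : {set {set T}}) : face_closed (fan_of_collections g PC).
Proof.
move=> s t; rewrite !inE => /forall_inP sP ts; apply/forall_inP => P PC_P.
by apply: contra (sP _ PC_P) => /subset_trans; apply.
Qed.

(** A set that is not a cone contains a minimal such set, which is primitive. *)
Lemma cone_no_primitive (F : fan) (s : {set ray F}) : face_closed F ->
  (s \in cones F) = [forall P in primitive_collections F, ~~ (P \subset s)].
Proof.
move=> Ffc; apply/idP/forall_inP => [sF P|noP].
  rewrite inE => /andP[PF _]; apply: contra PF; exact: Ffc sF.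
apply: contraT => sF.
have [P /minsetP[PF Pmin] Ps] :=
  @minset_exists _ (fun t : {set ray F} => t \notin cones F) s sF.
suff /noP/negP[] : P \in primitive_collections F by [].
rewrite inE PF; apply/forallP => Q; apply/implyP => /properP[QP [r rP rQ]].
by apply: contraT => /Pmin/(_ QP) QE; rewrite QE rP in rQ.
Qed.

Section Lift.

Variables (F : fan) (x : ray F) (p : nat).

Local Notation lray := (ray F + 'I_p.-1)%type.

(** [z_1, ..., z_p] lie over [x], every other ray over itself. *)
Definition base (z : lray) : ray F := if z is inl r then r else x.

Definition full_part (s : {set lray}) : {set ray F} :=
  [set r | [forall z, (base z == r) ==> (z \in s)]].

Lemma full_partP (s : {set lray}) r :
  reflect (forall z, base z = r -> z \in s) (r \in full_part s).
Proof.
rewrite inE; apply: (iffP forallP) => [sr z /eqP zr|sr z].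
  exact: (implyP (sr z)).
by apply/implyP => /eqP; apply: sr.
Qed.

Lemma lift_collection_sub (P : {set ray F}) (s : {set lray}) :
  (lift_collection x p P \subset s) = (P \subset full_part s).
Proof.
apply/subsetP/subsetP => [sub r rP|sub z].
  apply/full_partP => -[r'|k] /= rE; apply: sub; rewrite in_setU.
    by rewrite rE imset_f.
  by rewrite rE rP imset_f ?inE ?orbT.
case/setUP => [/imsetP[r rP ->]|].
  by apply: (full_partP _ _ (sub _ rP)).
case: ifP => [xP /imsetP[k _ ->]|_]; last by rewrite inE.
by apply: (full_partP _ _ (sub _ xP)).
Qed.

Lemma face_closed_lift : face_closed (bundle_lift x p).
Proof. exact: face_closed_collections. Qed.

Hypothesis Ffc : face_closed F.

(** A lifted collection lies in [s] iff the original one consists of rays with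
    full fiber in [s]. *)
Lemma cone_lift (s : {set lray}) :
  (s \in cones (bundle_lift x p)) = (full_part s \in cones F).
Proof.
rewrite (cone_no_primitive _ Ffc) inE.
apply/forall_inP/forall_inP => H P PF.
  by rewrite -lift_collection_sub H ?imset_f.
by case/imsetP: PF => Q QF ->; rewrite lift_collection_sub H.
Qed.

(** * Ampleness on a lift *)

Lemma sum_fiber (V : nmodType) (f : lray -> V) r :
  (\sum_(z | base z == r) f z =
   f (inl r) + (if r == x then \sum_k f (inr k) else 0))%R.
Proof.
rewrite big_sumType /= (eq_bigl (pred1 r)) ?big_pred1_eq //.
congr (_ + _)%R; rewrite [x == r]eq_sym.
by case: (r == x) => //; rewrite big_pred0.
Qed.

(** This is the relation [z_1 + ... + z_p = x], the source of all relations
    among the new rays. *)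
Lemma sum_fiber_gen r :
  (\sum_(z | base z == r) lift_gen x z = row_mx (gen r) 0)%R.
Proof.
rewrite sum_fiber /=; case: (r == x); last by rewrite addr0.
apply/rowP => j; rewrite mxE summxE; case: (split_ordP j) => k ->; last first.
  under eq_bigr => i _ do rewrite row_mxEr mxE eqxx /=.
  rewrite !row_mxEr (bigD1 k) //= big1 ?mxE ?eqxx ?addr0 ?addNr //.
  by move=> i /negPf ik; rewrite eq_sym ik.
rewrite !row_mxEl big1 ?addr0 // => i _.
by rewrite row_mxEl mxE.
Qed.

Lemma sum_fiber_pairing (mu : 'cV[int]_(fdim F + p.-1)) r :
  (\sum_(z | base z == r) (lift_gen x z *m mu) 0 0 =
   (gen r *m usubmx mu) 0 0)%R.
Proof.
rewrite -summxE -mulmx_suml sum_fiber_gen -{1}[mu]vsubmxK mul_row_col.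
by rewrite mul0mx addr0.
Qed.

(** The generators of the lift satisfy no other relations than those pulled back
    from [F]: the values of a linear form on the [z_k] can be prescribed, once
    their sum is its value at [x]. *)
Lemma pairing_from_fibers (mu : 'cV[int]_(fdim F)) (h : lray -> int) :
  (forall r, \sum_(z | base z == r) h z = (gen r *m mu) 0 0)%R ->
  exists mu' : 'cV[int]_(fdim F + p.-1),
    forall z, ((lift_gen x z *m mu') 0 0 = h z)%R.
Proof.
move=> hmu; exists (col_mx mu (\col_k h (inr k)))%R.
case=> [r|k] /=; last first.
  by rewrite mul_row_col mul0mx add0r -rowE !mxE.
rewrite mul_row_col [LHS]mxE -hmu sum_fiber; case: (r == x); last first.
  by rewrite mul0mx mxE !addr0.
rewrite [X in (_ + X)%R]mxE -[RHS]addr0 -addrA; congr (_ + _)%R.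
rewrite -big_split big1 // => k _.
by rewrite !mxE mulN1r /= addrN.
Qed.

(** A maximal cone of the lift has a maximal cone [t] of [F] as its full part,
    and omits exactly one ray over each ray outside [t]. The values of a
    linear form on the rays of such a fiber other than the omitted one are
    prescribed, so that the strict inequality at the omitted ray is the one
    for the fiber sum. *)
Lemma ample_lift (a : lray -> int) :
  ample (F := bundle_lift x p) a <->
  ample (F := F) (fun r => \sum_(z | base z == r) a z)%R.
Proof.
split=> amp.
  move=> t /maxsetP[/= tF tmax].
  (* any choice of one omitted ray per fiber gives a maximal cone above t *)
  pose s : {set lray} := [set z | (base z \in t) || (z != inl (base z))].
  have st : full_part s = t.
    apply/setP => r; apply/full_partP/idP => [/(_ (inl r) erefl)|rt z zr].
      by rewrite inE eqxx orbF.
    by rewrite inE zr rt.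
  have smax : maxset [pred u | u \in cones (bundle_lift x p)] s.
    apply/maxsetP; split=> [|s' /=]; first by rewrite /= cone_lift st.
    rewrite cone_lift => s'F ss'; apply/eqP; rewrite eqEsubset ss' andbT.
    apply/subsetP => z zs'; rewrite inE orbC -implybE; apply/implyP => /eqP zE.
    suff <- : full_part s' = t.
      apply/full_partP => z'; case: (eqVneq z' z) => [-> //|z'z] z'b.
      by apply: (subsetP ss'); rewrite inE z'b -zE z'z orbT.
    apply: tmax => //; rewrite -st; apply/subsetP => r /full_partP rs.
    by apply/full_partP => z' /rs; apply: (subsetP ss').
  have [mu muP] := amp _ smax; exists (usubmx mu) => r.
  rewrite -sum_fiber_pairing; case: ifP => rt.
    rewrite -sumrN; apply: eq_bigr => z /eqP zr.
    by have := muP z; rewrite inE zr rt.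
  rewrite (bigD1 (inl r)) // [X in (_ < X)%R](bigD1 (inl r)) //= opprD.
  rewrite -sumrN [X in (_ + X < _)%R](eq_bigr
      (fun z => (lift_gen x z *m mu) 0 0)%R).
    rewrite ltrD2r; have := muP (inl r); rewrite inE /= rt eqxx /=; exact.
  move=> z /andP[/eqP zr znr]; have := muP z; rewrite inE zr znr orbT.
  by move=> ->.
move=> s /maxsetP[/= sF smax].
have tF := sF; rewrite cone_lift in tF.
have tmax : maxset [pred u | u \in cones F] (full_part s).
  apply/maxsetP; split=> [//|t' /= t'F tt']; apply/eqP.
  rewrite eqEsubset tt' andbT; apply/subsetP => r rt'; apply/full_partP => z zr.
  suff <- : s :|: [set z | base z \in t'] = s by rewrite !inE zr rt' orbT.
  apply: smax; last exact: subsetUl.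
  rewrite /= cone_lift; apply: Ffc t'F _; apply/subsetP => r' /full_partP r's.
  apply: contraT => r't'; rewrite -(negPf r't').
  apply: (subsetP tt'); apply/full_partP => z' z'r'.
  by have := r's z' z'r'; rewrite !inE z'r' (negPf r't') orbF.
have smiss z z' : z \notin s -> z' \notin s -> base z = base z' -> z = z'.
  move=> zs z's zz'; apply/eqP; apply: contraNT zs => zNz'.
  suff <- : z |: s = s by rewrite !inE eqxx.
  apply: smax; last exact: subsetUr.
  rewrite /= cone_lift; apply: Ffc tF _; apply/subsetP => r /full_partP rs.
  apply/full_partP => z2 z2r; have := rs _ z2r.
  rewrite in_setU1 => /orP[/eqP z2z|//]; have := rs z'.
  rewrite in_setU1 (negPf z's) -zz' -z2z z2r z2z eq_sym (negPf zNz').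
  by move=> /(_ erefl).
have [mu muP] := amp _ tmax.
pose h z := if z \in s then (- a z)%R else
  ((gen (base z) *m mu) 0 0 +
   \sum_(z' | (base z' == base z) && (z' != z)) a z')%R.
have [r|mu' mu'P] := @pairing_from_fibers mu h.
  have := muP r; case: ifP => [/full_partP rt ->|/negP rt _].
    rewrite -sumrN; apply: eq_bigr => z /eqP /rt zs.
    by rewrite /h zs.
  have [z zr zs] : exists2 z, base z = r & z \notin s.
    move: rt; rewrite inE => /negP/forallPn[z].
    by rewrite negb_imply => /andP[/eqP]; exists z.
  rewrite (bigD1 z) /=; last by rewrite zr.
  rewrite {1}/h (negPf zs) zr -addrA -big_split /= big1 ?addr0 //.
  move=> z' /andP[z'r z'z].
  rewrite /h; case: ifP => [_|/negbT z's]; first by rewrite addrN.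
  by rewrite (smiss z' z) ?eqxx ?zr ?(eqP z'r) in z'z.
exists mu' => z; rewrite /= mu'P /h; case: (boolP (z \in s)) => zs //.
have := muP (base z); case: ifP => [/full_partP/(_ z erefl)|_].
  by rewrite (negPf zs).
by rewrite (bigD1 z) //= opprD ltrBlDr.
Qed.

(** * Completeness and smoothness of a lift *)

Lemma ray_lift :
  (forall r : ray F, [set r] \in cones F) ->
  forall z : lray, [set z] \in cones (bundle_lift x p).
Proof.
move=> Fray z; rewrite cone_lift; apply: Ffc (Fray (base z)) _.
apply/subsetP => r /full_partP/(_ (inl r) erefl).
by rewrite !inE => /eqP <-.
Qed.

Lemma fiber_min (R : realType) (c : lray -> R) :
  exists2 z, base z = x & forall z', base z' = x -> (c z <= c z')%R.
Proof.
have xx : base (inl x) == x by [].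
have [z /= /eqP zx zmin] :=
  @arg_minP _ _ _ (inl x) [pred z | base z == x] c xx.
by exists z => // z' /eqP/zmin.
Qed.

End Lift.

Section Coordinates.

Local Open Scope ring_scope.

Variable R : realType.

Definition rayvec (F : fan) (c : ray F -> R) : 'rV[R]_(fdim F) :=
  \sum_r c r *: map_mx intr (gen r).

Definition supp (T : finType) (c : T -> R) : {set T} := [set r | c r != 0].

(** Every vector has exactly one nonnegative expression supported on a cone:
    existence is completeness, uniqueness replaces the intersection axiom. *)
Record cone_coordinates (F : fan) : Prop := {
  coordinates_unique : forall c c' : ray F -> R,
    (forall r, 0 <= c r) -> (forall r, 0 <= c' r) ->
    supp c \in cones F -> supp c' \in cones F ->
    rayvec c = rayvec c' -> c =1 c';
  coordinates_exist : forall v : 'rV[R]_(fdim F), exists c : ray F -> R,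
    [/\ forall r, 0 <= c r, supp c \in cones F & rayvec c = v] }.

Definition unimodular_cones (F : fan) : Prop :=
  forall s : {set ray F}, s \in cones F ->
  exists (B : 'M[int]_(fdim F)) (f : ray F -> 'I_(fdim F)),
    [/\ B \in unitmx, {in s &, injective f}
      & forall r, r \in s -> gen r = row (f r) B].

Lemma rayvec_supp (F : fan) (c : ray F -> R) (s : {set ray F}) :
  (forall r, c r != 0 -> r \in s) ->
  rayvec c = \sum_(r in s) c r *: map_mx intr (gen r).
Proof.
move=> cs; rewrite [RHS]big_mkcond; apply: eq_bigr => r _.
case: ifPn => // rs; suff -> : c r = 0 by rewrite scale0r.
by apply/eqP; apply: contraNT rs => /cs.
Qed.

(** Two expressions of a vector, on the cones [s] and [t], are the same one,
    hence live on the intersection. *)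
Lemma smooth_complete_coordinates (F : fan) :
  (forall r : ray F, [set r] \in cones F) -> face_closed F ->
  cone_coordinates F -> unimodular_cones F -> smooth_complete_fan R F.
Proof.
move=> Fray Ffc [Funiq Fex] Funi; split=> // [s t sF tF v|v]; last first.
  have [c [c0 cF <-]] := Fex v; exists (supp c) => //.
  by exists c => //; apply: rayvec_supp => r; rewrite inE.
have cut u : u \in cones F -> in_cone u v -> exists c : ray F -> R,
    [/\ forall r, 0 <= c r, supp c \in cones F, rayvec c = v
      & forall r, c r != 0 -> r \in u].
  move=> uF [c c0 ->]; pose c' r := if r \in u then c r else 0.
  have c'u r : c' r != 0 -> r \in u by rewrite /c'; case: ifP; rewrite ?eqxx.
  exists c'; split=> //; first by move=> r; rewrite /c'; case: ifP.
    by apply: Ffc uF _; apply/subsetP => r; rewrite inE => /c'u.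
  by rewrite (rayvec_supp c'u); apply: eq_bigr => r ru; rewrite /c' ru.
move=> /(cut _ sF)[c [c0 cF cv cs]] /(cut _ tF)[c' [c'0 c'F c'v c't]].
have cc' : c =1 c' by apply: Funiq; rewrite ?cv.
exists c => //; rewrite -cv; apply: rayvec_supp => r rc.
by rewrite inE cs ?c't // -cc'.
Qed.

Variables (F : fan) (x : ray F) (p : nat).

Hypothesis Ffc : face_closed F.

Local Notation lray := (ray F + 'I_p.-1)%type.

Lemma rayvec_bump (c : ray F -> R) (e : R) :
  rayvec (fun r => c r + (if r == x then e else 0)) =
  rayvec c + e *: map_mx intr (gen x).
Proof.
rewrite /rayvec; under eq_bigr => r _ do rewrite scalerDl.
rewrite big_split /=; congr (_ + _).
rewrite (bigD1 x) //= eqxx big1 ?addr0 // => r /negPf ->.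
by rewrite scale0r.
Qed.

Lemma rayvec_lift (c : lray -> R) :
  rayvec (F := bundle_lift x p) c =
  row_mx (rayvec (c \o inl)) (\row_k (c (inr k) - c (inl x))).
Proof.
apply/rowP => j; rewrite /rayvec summxE big_sumType /=.
case: (split_ordP j) => k ->.
  rewrite row_mxEl summxE [X in _ + X]big1 ?addr0.
    by apply: eq_bigr => r _; rewrite map_row_mx scale_row_mx row_mxEl.
  by move=> i _; rewrite map_row_mx scale_row_mx row_mxEl !mxE mulr0.
rewrite row_mxEr mxE addrC; congr (_ + _).
  rewrite (bigD1 k) //= big1 ?addr0.
    by rewrite map_row_mx scale_row_mx row_mxEr !mxE !eqxx mulr1.
  move=> i /negPf ik; rewrite map_row_mx scale_row_mx row_mxEr !mxE.
  by rewrite eq_sym ik andbF mulr0.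
rewrite (bigD1 x) //= big1 ?addr0.
  by rewrite map_row_mx scale_row_mx row_mxEr eqxx !mxE rmorphN mulrN1.
by move=> r /negPf rx; rewrite map_row_mx scale_row_mx row_mxEr rx !mxE mulr0.
Qed.

(** Relations of the lift are constant on the fiber of [x]. Subtracting from an
    expression its minimum over this fiber therefore leaves an expression whose
    support misses a ray of the fiber, and this minimum is the coefficient of
    [x] in the corresponding expression in [F]. *)
Lemma cone_coordinates_lift :
  cone_coordinates F -> cone_coordinates (bundle_lift x p).
Proof.
move=> [Funiq Fex]; split=> [c c' c0 c'0 cF c'F|v].
  rewrite !rayvec_lift => /eq_row_mx[eql /rowP eqr].
  have [z zx zmin] := fiber_min x c; have [z' z'x z'min] := fiber_min x c'.
  (* two expressions of the same vector differ by a constant on the fiber *)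
  have shift u : base x u = x -> c u - c' u = c (inl x) - c' (inl x).
    by case: u => [r /= ->|k _] //; have := eqr k; rewrite !mxE; lra.
  have low (d : lray -> R) u : (forall t, 0 <= d t) ->
      supp d \in cones (bundle_lift x p) -> base x u = x ->
      (forall t, base x t = x -> d u <= d t) ->
      let b r := d (inl r) + (if r == x then d u - d (inl x) else 0) in
      (forall r, 0 <= b r) /\ supp b \in cones F.
    move=> d0 dF ux umin b.
    have bx : b x = d u by rewrite /b eqxx addrC subrK.
    have bN r : r != x -> b r = d (inl r).
      by move=> /negPf rx; rewrite /b rx addr0.
    split=> [r|]; first by case: (eqVneq r x) => [->|/bN ->]; rewrite ?bx.
    move: dF; rewrite cone_lift // => /Ffc; apply; apply/subsetP => r.
    rewrite inE => br; apply/full_partP => t tr; rewrite inE.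
    case: (eqVneq r x) br => [rx|rx].
      rewrite rx bx => du; rewrite gt_eqF // (lt_le_trans _ (umin t _)) ?tr //.
      by rewrite lt_def du d0.
    rewrite bN //; case: t tr => [r' /= -> //|k /= xr].
    by rewrite xr eqxx in rx.
  have [b0 bF] := low c z c0 cF zx zmin.
  have [b'0 b'F] := low c' z' c'0 c'F z'x z'min.
  have gap : c z - c (inl x) = c' z' - c' (inl x).
    have := shift z zx; have := shift z' z'x.
    have := zmin z' z'x; have := z'min z zx; lra.
  have eqb : rayvec (c \o inl) + (c z - c (inl x)) *: map_mx intr (gen x) =
     rayvec (c' \o inl) + (c' z' - c' (inl x)) *: map_mx intr (gen x).
    by rewrite eql gap.
  rewrite -!rayvec_bump in eqb; have bb' := Funiq _ _ b0 b'0 bF b'F eqb.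
  have inlE r : c (inl r) = c' (inl r).
    have := bb' r; rewrite /= gap; by case: (r == x); lra.
  case=> [r|k]; first exact: inlE.
  have := shift (inr k) erefl; rewrite inlE; lra.
(* the coordinates of v along the new directions are the differences between
   the coefficients of the z_k, k < p, and that of z_p *)
pose g (z : lray) := if z is inr k then rsubmx v 0 k else 0 : R.
have [z zx zmin] := fiber_min x g.
have [b [b0 bF bv]] := Fex (lsubmx v + g z *: map_mx intr (gen x)).
pose c (t : lray) := b (base x t) + (if base x t == x then g t - g z else 0).
exists c; split.
- move=> t; rewrite /c; case: eqP => [/zmin tx|_]; last by rewrite addr0.
  by rewrite addr_ge0 // subr_ge0.
- rewrite cone_lift //; apply: Ffc bF _; apply/subsetP => r /full_partP rc.
  rewrite inE; case: (eqVneq r x) rc => [->|rx] rc.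
    by have := rc z zx; rewrite inE /c zx eqxx addrN addr0.
  by have := rc (inl r) erefl; rewrite inE /c /= (negPf rx) addr0.
have cl : rayvec (c \o inl) = lsubmx v.
  apply: (@addIr _ (g z *: map_mx intr (gen x))); rewrite -bv -rayvec_bump.
  by apply: eq_bigr => r _; rewrite /c /= sub0r; case: eqP => _;
    rewrite -?addrA ?addNr ?addr0.
have cr : \row_k (c (inr k) - c (inl x)) = rsubmx v.
  by apply/rowP => k; rewrite mxE /c /= eqxx; lra.
by rewrite rayvec_lift cl cr; exact: hsubmxK.
Qed.

(** If the cone contains all the [z_k], or not the last one, then a basis
    of [N] adapted to the full part extends by [z_1, ..., z_(p-1)], with [x]
    replaced by [z_p] in the first case. Otherwise some [z_k0], [k0 < p],
    is missing, and [z_p] takes its place. *)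
Lemma unimodular_lift :
  unimodular_cones F -> unimodular_cones (bundle_lift x p).
Proof.
move=> Funi s sF; have tF := sF; rewrite cone_lift // in tF.
have [B [f [Bunit finj fE]]] := Funi _ tF.
have full r : r != x -> inl r \in s -> r \in full_part x s.
  move=> rx rs; apply/full_partP => -[r' /= -> //|k /= xr].
  by rewrite xr eqxx in rx.
have [inls|/existsP[k0 /andP[xs k0s]]] : 
  (forall r, inl r \in s -> r \in full_part x s) \/
  [exists k, (inl x \in s) && (inr k \notin s)].
- case: (boolP [exists k, _]) => [|/existsPn nok]; [by right|left=> r rs].
  case: (eqVneq r x) => [rx|/full]; last exact.
  rewrite {}rx in rs *; apply/full_partP => -[r' /= -> //|k _].
  by apply: contraT => ks; have := nok k; rewrite rs ks.
- pose C : 'M[int]_(fdim F, p.-1) :=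
    \matrix_(i, j) - ((x \in full_part x s) && (i == f x))%:R.
  exists (block_mx B C 0 1%:M : 'M_(fdim F + p.-1)).
  exists (fun z : lray => match z with inl r => lshift _ (f r)
                               | inr k => rshift _ k end).
  split.
  + by rewrite unitmxE det_ublock det1 mulr1 -unitmxE.
  + move=> [r|k] [r'|k'] zs zs' /eqP.
    * rewrite (inj_eq (@lshift_inj _ _)) => /eqP/finj.
      by move=> -> //; apply: inls.
    * by rewrite eq_lrshift.
    * by rewrite eq_rlshift.
    * by rewrite (inj_eq (@rshift_inj _ _)) => /eqP ->.
  case=> [r rs|k _] /=; apply/rowP => j; rewrite [RHS]mxE; last first.
    by rewrite /block_mx col_mxEd; case: (split_ordP j) => i ->;
      rewrite ?row_mxEl ?row_mxEr !mxE // eqxx eq_sym.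
  rewrite /block_mx col_mxEu; case: (split_ordP j) => i ->;
    rewrite ?row_mxEl ?row_mxEr.
    by rewrite fE ?inls // mxE.
  rewrite !mxE; case: (eqVneq r x) => [rx|rx].
    have xf : x \in full_part x s by rewrite -{1}rx inls.
    by rewrite mxE xf rx eqxx.
  rewrite mxE; case: (boolP (x \in _)) => //= xf.
  by rewrite (inj_in_eq finj) ?xf ?inls // (negPf rx) oppr0.
(* row k0 of (C D) is z_p, the other rows are the z_k *)
pose C : 'M[int]_(p.-1, fdim F) := \matrix_(i, j) ((i == k0)%:R * gen x 0 j).
pose D : 'M[int]_(p.-1) := \matrix_(i, j) (if i == k0 then -1 else (i == j)%:R).
have DD : D *m D = 1%:M.
  apply/matrixP => i j; rewrite !mxE; case: (eqVneq i k0) => [->|ik0].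
    under eq_bigr => k _ do rewrite !mxE eqxx mulN1r.
    rewrite sumrN (bigD1 k0) //= eqxx; case: (eqVneq k0 j) => [->|k0j].
      by rewrite big1 ?addr0 ?opprK // => k /negPf ->.
    have jk0 : j != k0 by rewrite eq_sym.
    rewrite (bigD1 j) //= (negPf jk0) eqxx big1.
      by rewrite addr0 addNr oppr0.
    by move=> k /andP[/negPf -> /negPf ->].
  rewrite (bigD1 i) //= big1.
    by rewrite !mxE (negPf ik0) eqxx mul1r addr0.
  by move=> k /negPf ki; rewrite !mxE (negPf ik0) eq_sym ki mul0r.
exists (block_mx B 0 C D : 'M_(fdim F + p.-1)).
exists (fun z : lray => match z with
  | inl r => if r == x then rshift _ k0 else lshift _ (f r)
  | inr k => rshift _ k end).
split.
- rewrite unitmxE det_lblock unitrM -!unitmxE Bunit.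
  by have [] := mulmx1_unit DD.
- have kk0 k : inr k \in s -> (k == k0) = false.
    by move=> ks; apply: contraNF k0s => /eqP <-.
  move=> [r|k] [r'|k'] zs zs' /=.
  + case: (eqVneq r x) => [->|rx]; case: (eqVneq r' x) => [->|r'x] // /eqP.
    * by rewrite eq_rlshift.
    * by rewrite eq_lrshift.
    rewrite (inj_eq (@lshift_inj _ _)) => /eqP/finj -> //; exact: full.
  + case: ifP => _ /eqP; last by rewrite eq_lrshift.
    by rewrite (inj_eq (@rshift_inj _ _)) eq_sym kk0.
  + case: ifP => _ /eqP; last by rewrite eq_rlshift.
    by rewrite (inj_eq (@rshift_inj _ _)) kk0.
  + by move=> /eqP; rewrite (inj_eq (@rshift_inj _ _)) => /eqP ->.
move=> [r rs|k ks] /=; apply/rowP => j; rewrite [RHS]mxE.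
  case: (eqVneq r x) => [->|rx].
    rewrite /block_mx col_mxEd; case: (split_ordP j) => i ->.
      by rewrite !row_mxEl mxE eqxx mul1r.
    by rewrite !row_mxEr !mxE eqxx.
  rewrite /block_mx col_mxEu; case: (split_ordP j) => i ->.
    by rewrite !row_mxEl fE ?full // mxE.
  by rewrite !row_mxEr !mxE.
have kk0 : k == k0 = false by apply: contraNF k0s => /eqP <-.
rewrite /block_mx col_mxEd; case: (split_ordP j) => i ->.
  by rewrite !row_mxEl !mxE kk0 mul0r.
by rewrite !row_mxEr !mxE kk0 eqxx eq_sym.
Qed.

End Coordinates.

(** * Iterated lifts *)

Section Iterated.

Lemma ample_ext (F : fan) (a b : ray F -> int) : a =1 b -> ample a -> ample b.
Proof.
move=> ab amp s /amp[mu muP]; exists mu => r.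
by rewrite -ab; apply: muP.
Qed.

Variables (T : Type) (w : T -> nat).

(** Each lift adds the weight of the lifted ray to its coefficient, by summing
    the coefficients [1] of the new rays. *)
Lemma Fano_lift_along (s : seq T) (F : fan) (emb : T -> ray F) :
  face_closed F ->
  Fano (lift_along w emb s) <->
  ample (fun r => (\sum_(t <- s | emb t == r) w t).+1%:Z%R).
Proof.
elim: s F emb => [|t s IHs] F emb Ffc /=.
  by split; apply: ample_ext => r; rewrite big_nil.
apply: (iff_trans (IHs _ _ (@face_closed_lift _ _ _))).
apply: (iff_trans (@ample_lift F (emb t) (w t).+1 Ffc _)).
suff aE r : (\sum_(z | @base F (emb t) (w t).+1 z == r)
     (\sum_(u <- s | inl (emb u) == z) w u).+1%:Z =
     (\sum_(u <- t :: s | emb u == r) w u).+1%:Z)%R.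
  by split; apply: ample_ext => r; rewrite aE.
rewrite (@sum_fiber F (emb t) (w t).+1) big_cons /=.
rewrite [X in if _ then X else _](eq_bigr (fun=> 1%R)); last first.
  by move=> k _; rewrite big_pred0.
rewrite sumr_const card_ord eq_sym; case: (emb t == r); last by rewrite addr0.
by rewrite natz -PoszD addSn addnC.
Qed.

Lemma fdim_lift_along (s : seq T) (F : fan) (emb : T -> ray F) :
  fdim (lift_along w emb s) = fdim F + \sum_(t <- s) w t.
Proof.
elim: s F emb => [|t s IHs] F emb /=; first by rewrite big_nil addn0.
by rewrite IHs big_cons addnA.
Qed.

Lemma smooth_complete_lift_along (R : realType) (s : seq T) (F : fan)
    (emb : T -> ray F) :
  (forall r : ray F, [set r] \in cones F) -> face_closed F ->
  cone_coordinates R F -> unimodular_cones F ->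
  smooth_complete_fan R (lift_along w emb s).
Proof.
elim: s F emb => [|t s IHs] F emb Fray Ffc Fcoord Funi /=.
  exact: smooth_complete_coordinates.
apply: IHs.
- exact: ray_lift.
- exact: face_closed_lift.
- exact: cone_coordinates_lift.
- exact: unimodular_lift.
Qed.

End Iterated.

(** * Cones of the model *)

Lemma subset_between (T : finType) (A B : {set T}) k :
  A \subset B -> #|A| <= k <= #|B| ->
  exists S : {set T}, [/\ A \subset S, S \subset B & #|S| = k].
Proof.
move=> AB /andP[Ak kB].
have /card_geqP[l [lu lk lD]] : k - #|A| <= #|B :\: A|.
  by rewrite cardsD (setIidPr AB) leq_sub2r.
exists (A :|: [set:: l]); split.
- exact: subsetUl.
- rewrite subUset AB; apply/subsetP => u; rewrite inE => /lD.
  by rewrite inE => /andP[].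
rewrite cardsU (_ : A :&: _ = set0) ?cards0 ?subn0.
  by rewrite cardsE (card_uniqP lu) lk subnKC.
apply/setP => u; rewrite !inE; apply/negP => /andP[uA /lD].
by rewrite inE uA.
Qed.

Section Model.

Variables (m n : nat) (le_n : n <= m.*2.+2).
Hypothesis lt_mn : m < n.

Local Notation Y := (Ymn le_n).
Local Notation idx := 'I_m.*2.+2.
Local Notation widx := (Defs.widx le_n).

Lemma widx_inj : injective widx.
Proof. by move=> i i' /(congr1 val) /= /val_inj. Qed.

Lemma card_widx (I : {set 'I_n}) : #|widx @: I| = #|I|.
Proof. exact: (card_imset _ widx_inj). Qed.

Lemma mem_widx (I : {set 'I_n}) i : (widx i \in widx @: I) = (i \in I).
Proof. exact: (mem_imset _ _ widx_inj). Qed.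

(** A set of rays of the model is described by the indices of its [y]-rays and
    by those of the [x]-rays that it lacks. *)
Definition yset (s : {set ray Y}) : {set 'I_n} := [set i | inr i \in s].
Definition xco (s : {set ray Y}) : {set idx} := [set j | inl j \notin s].

(** The three kinds of primitive collections give the three conditions. An
    [m]-subset of the first [n] indices contains the missing [x]-indices iff
    these are at most [m] in number and all among the first [n]. *)
Lemma cone_YmnP (s : {set ray Y}) :
  reflect [/\ widx @: yset s \subset xco s, #|yset s| <= m
            & m < #|xco s| \/ exists2 j : idx, n <= j & j \in xco s]
          (s \in cones Y).
Proof.
rewrite inE; apply: (iffP forall_inP) => [sP|[disj ym xm] P].
  split.
  - apply/subsetP => _ /imsetP[i iy ->]; rewrite inE.
    have : [set inl (widx i); inr i] \in Ycollections le_n.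
      by rewrite !inE -orbA; apply/orP; left; apply/imsetP; exists i.
    move=> /sP; apply: contra => xs; rewrite inE in iy.
    by rewrite subUset !sub1set xs iy.
  - rewrite leqNgt; apply/negP => my.
    have [|J [_ Jy Jm]] := @subset_between _ set0 (yset s) m.+1 (sub0set _).
      by rewrite cards0 my.
    have /sP/negP[] : inr @: J \in Ycollections le_n.
      rewrite in_setU; apply/orP; right.
      by apply/imsetP; exists J; rewrite ?inE ?Jm.
    apply/subsetP => _ /imsetP[i /(subsetP Jy) iy ->].
    by rewrite inE in iy.
  case: (ltnP m #|xco s|) => [|xm]; first by left.
  right; have [/exists_inP //|/exists_inPn nox] :=
    boolP [exists (j : idx | n <= j), j \in xco s]; exfalso.
  pose X := [set i | widx i \in xco s].
  have xE : xco s = widx @: X.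
    apply/setP => j; apply/idP/imsetP => [jx|[i iX ->]]; last first.
      by rewrite inE in iX.
    have jn : j < n by rewrite ltnNge; apply: contraL jx => /nox.
    have jE : j = widx (Ordinal jn) by apply: val_inj.
    by exists (Ordinal jn) => //; rewrite inE -jE.
  have [|I [XI _ Im]] := @subset_between _ X setT m (subsetT _).
    by rewrite -card_widx -xE xm cardsT card_ord ltnW.
  have /sP/negP[] : inl @: (~: (widx @: I)) \in Ycollections le_n.
    rewrite !in_setU; apply/orP; left; apply/orP; right.
    by apply/imsetP; exists I; rewrite ?inE ?Im.
  apply/subsetP => _ /imsetP[j + ->]; rewrite inE => jI.
  apply: contraNT jI => js; have : j \in xco s by rewrite inE.
  by rewrite xE => /imsetP[i /(subsetP XI) iI ->]; rewrite mem_widx.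
rewrite !in_setU -orbA => /or3P[] /imsetP[].
- move=> i _ ->; rewrite subUset !sub1set negb_and.
  case: (boolP (inr i \in s)) => [iy|_]; last by rewrite orbT.
  have := subsetP disj (widx i); rewrite mem_widx !inE iy => -> //.
- move=> I; rewrite inE => /eqP Im ->; apply/negP => /subsetP Is.
  have xI : xco s \subset widx @: I.
    apply/subsetP => j; rewrite inE; apply: contraR => jI.
    by apply: Is; rewrite imset_f ?inE.
  case: xm => [|[j nj /(subsetP xI)/imsetP[i _ jE]]].
    by rewrite ltnNge (leq_trans (subset_leq_card xI)) // card_widx Im.
  by rewrite leqNgt jE /= ltn_ord in nj.
move=> J; rewrite inE => /eqP Jm ->; apply/negP => /subsetP Js.
have /subset_leq_card : J \subset yset s.
  by apply/subsetP => i iJ; rewrite inE Js ?imset_f.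
by rewrite Jm ltnNge ym.
Qed.

Lemma face_closed_Ymn : face_closed Y.
Proof. exact: face_closed_collections. Qed.

Lemma ray_Ymn (r : ray Y) : 0 < m -> [set r] \in cones Y.
Proof.
move=> m_gt0; apply/cone_YmnP; case: r => [j|i]; split.
- by apply/subsetP => k /imsetP[i]; rewrite !inE.
- by rewrite (_ : yset _ = set0) ?cards0 //; apply/setP => i; rewrite !inE.
- left; rewrite (_ : xco _ = [set~ j]); last first.
    by apply/setP => j'; rewrite !inE.
  by rewrite cardsC1 card_ord; lia.
- by apply/subsetP => _ /imsetP[i' _ ->]; rewrite !inE.
- rewrite (_ : yset _ = [set i]) ?cards1 //; apply/setP => i'.
  by rewrite !inE.
- left; rewrite (_ : xco _ = setT) ?cardsT ?card_ord; first lia.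
  by apply/setP => j; rewrite !inE.
Qed.

(** Missing [x]-indices that are not used by the [y]-rays can be filled in,
    down to a last one, either by an [x]-ray or, while there are fewer than
    [m] [y]-rays, by a [y]-ray. *)
Lemma maximal_cone_Ymn (s : {set ray Y}) :
  maxset [pred t | t \in cones Y] s ->
  exists k : idx, [/\ k \notin widx @: yset s, xco s = k |: widx @: yset s,
    #|yset s| <= m & #|yset s| = m \/ n <= k].
Proof.
move=> /maxsetP[/= sY smax]; have /cone_YmnP[disj ym xm] := sY.
(* by maximality, a ray that can be added is already there *)
have add r : r |: s \in cones Y -> r \in s.
  by move=> /smax <-; rewrite ?subsetUr // !inE eqxx.
have yadd (j : idx) : yset (inl j |: s) = yset s.
  by apply/setP => i; rewrite !inE.
have xadd (j : idx) : xco (inl j |: s) = xco s :\ j.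
  by apply/setP => j'; rewrite !inE negb_or.
have alone k : k \in xco s -> k \notin widx @: yset s ->
    m < #|k |: widx @: yset s| \/ n <= k -> xco s = k |: widx @: yset s.
  move=> kx ky kbig; apply/eqP.
  rewrite eqEsubset subUset sub1set kx disj !andbT.
  apply/subsetP => j jx; rewrite in_setU1; apply: contraT.
  rewrite negb_or => /andP[jk jy].
  move: (jx); rewrite inE => /negP[]; apply: add.
  apply/cone_YmnP; rewrite yadd xadd; split=> //.
    by rewrite subsetD1 disj.
  case: kbig => [big|nk]; last first.
    by right; exists k => //; rewrite in_setD1 eq_sym jk kx.
  left; apply: leq_trans big (subset_leq_card _).
  by rewrite subUset sub1set subsetD1 disj jy in_setD1 eq_sym jk kx.
have [/exists_inP[k nk kx]|/exists_inPn xn] :=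
    boolP [exists (j : idx | n <= j), j \in xco s].
  have ky : k \notin widx @: yset s.
    by apply: contraL nk => /imsetP[i _ ->]; rewrite -ltnNge /= ltn_ord.
  by exists k; split=> //; [apply: alone => //; right | right].
have {}xm : m < #|xco s|.
  by case: xm => // -[j /xn /negP nj /nj].
have yx (i : 'I_n) : widx i \in xco s -> #|yset s| < m -> i \in yset s.
  move=> ix ylt; rewrite inE; apply: add; apply/cone_YmnP.
  have yE : yset (inr i |: s) = i |: yset s by apply/setP => i'; rewrite !inE.
  have xE : xco (inr i |: s) = xco s by apply/setP => i'; rewrite !inE.
  rewrite yE xE; split; last by left.
    by rewrite imsetU1 subUset sub1set ix.
  by rewrite (leq_trans (leq_card_setU _ _)) // cards1.
have [k kx ky] : exists2 k, k \in xco s & k \notin widx @: yset s.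
  apply/subsetPn; apply: contraTN xm => /subset_leq_card; rewrite card_widx.
  by rewrite -leqNgt => /leq_trans; apply.
have {}ym : #|yset s| = m.
  apply/eqP; rewrite eqn_leq ym leqNgt; apply: contra ky => ylt.
  have kn : k < n by rewrite ltnNge; apply: contraL kx => /xn.
  have kE : k = widx (Ordinal kn) by apply: val_inj.
  by rewrite kE mem_widx yx // -kE.
exists k; split; rewrite ?ym //; last by left.
by apply: alone => //; left; rewrite cardsU1 ky card_widx ym.
Qed.

(** The cone condition leaves an index carrying neither an [x]-ray nor a
    [y]-ray: there are either too many missing [x]-indices, or one beyond [n].
    *)
Lemma missing_index (s : {set ray Y}) : s \in cones Y ->
  exists2 k, k \in xco s & k \notin widx @: yset s.
Proof.
move=> /cone_YmnP[disj ym [xm|[k nk kx]]].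
  apply/subsetPn; apply: contraTN xm => /subset_leq_card; rewrite card_widx.
  by rewrite -leqNgt => /leq_trans; apply.
exists k => //.
by apply: contraL nk => /imsetP[i _ ->]; rewrite -ltnNge /= ltn_ord.
Qed.

(** * Ampleness on the model *)

Section Pairing.

Local Open Scope ring_scope.

Lemma xgenE (j : idx) l :
  xgen j 0 l = (lift ord_max l == j)%:R - (ord_max == j)%:R.
Proof.
rewrite /xgen; case: unliftP => [k ->|->]; rewrite mxE.
  by rewrite (inj_eq lift_inj) eqxx (negPf (neq_lift _ _)) subr0.
by rewrite eqxx eq_sym (negPf (neq_lift _ _)) sub0r.
Qed.

Lemma sum_indicator (V : pzRingType) (I : finType) (i : I) (f : I -> V) :
  \sum_j (i == j)%:R * f j = f i.
Proof.
rewrite (bigD1 i) //= eqxx mul1r big1 ?addr0 // => j /negPf ji.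
by rewrite eq_sym ji mul0r.
Qed.

Lemma sum_xgen : \sum_j xgen j = 0 :> 'rV[int]_m.*2.+1.
Proof.
apply/rowP => l; rewrite summxE mxE; under eq_bigr => j _ do rewrite xgenE.
rewrite sumrB -(eq_bigr _ (fun j _ => mulr1 _)) (sum_indicator _ (fun=> 1)).
by rewrite -(eq_bigr _ (fun j _ => mulr1 _)) (sum_indicator _ (fun=> 1)) subrr.
Qed.

(** As [sum_j x_j = 0] generates the relations among the [x_j], linear forms are
    the functions of sum zero. *)
Lemma xgen_pairing (h : idx -> int) : \sum_j h j = 0 ->
  exists mu : 'cV[int]_m.*2.+1, forall j, (xgen j *m mu) 0 0 = h j.
Proof.
rewrite (bigD1_ord ord_max) //= => /eqP; rewrite addr_eq0 => /eqP hmax.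
exists (\col_l h (lift ord_max l)) => j; rewrite /xgen.
case: unliftP => [k ->|->]; first by rewrite -rowE !mxE.
rewrite hmax -sumrN mxE; apply: eq_bigr => l _.
by rewrite !mxE mulN1r.
Qed.

Lemma sum_xgen_pairing (mu : 'cV[int]_m.*2.+1) :
  \sum_j (xgen j *m mu) 0 0 = 0.
Proof. by rewrite -summxE -mulmx_suml sum_xgen mul0mx mxE. Qed.

End Pairing.

(** Positivity of the degrees of the primitive relations
    [sum_(j notin I) x_j = sum_(i in I) y_i] and
    [sum_(j in J) y_j = sum_(j notin J) x_j] of the divisor with coefficients
    [1 + w r]. *)
Definition positive_degrees (w : ray Y -> nat) : Prop :=
  (forall I : {set 'I_n}, #|I| = m ->
     \sum_(i in I) (w (inr i)).+1
       < \sum_(j in ~: (widx @: I)) (w (inl j)).+1) /\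
  (forall J : {set 'I_n}, #|J| = m.+1 ->
     \sum_(j in ~: (widx @: J)) (w (inl j)).+1
       < \sum_(i in J) (w (inr i)).+1).

Lemma big_split_widx (V : Type) (e : V) (op : Monoid.com_law e)
    (I : {set 'I_n}) (h : idx -> V) :
  \big[op/e]_j h j =
  op (\big[op/e]_(i in I) h (widx i)) (\big[op/e]_(j in ~: (widx @: I)) h j).
Proof.
rewrite (bigID (mem (widx @: I))) /= big_imset /=; last exact: in2W widx_inj.
by congr (op _ _); apply: eq_bigl => j; rewrite inE.
Qed.

Lemma ltr_sum_strict (I : finType) (A : {set I}) (f g : I -> int) i :
  i \in A -> (f i < g i)%R -> (forall k, k \in A -> (f k <= g k)%R) ->
  (\sum_(k in A) f k < \sum_(k in A) g k)%R.
Proof.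
move=> iA fgi fg; rewrite (bigD1 i) // [ltRHS](bigD1 i) //=.
by rewrite ltr_leD // ler_sum // => k /andP[/fg].
Qed.

Lemma sumPosz (I : finType) (A : {set I}) (f : I -> nat) :
  (\sum_(i in A) (f i)%:Z = (\sum_(i in A) f i)%:Z)%R.
Proof. by rewrite (big_morph Posz PoszD (erefl 0%Z)). Qed.

(** Evaluate, on a primitive relation, the linear form of a maximal cone
    containing the right-hand side. It does not contain the whole left-hand
    side, a primitive collection, so one of the inequalities there is strict.
    *)
Lemma ample_degrees (w : ray Y -> nat) :
  ample (F := Y) (fun r => (w r).+1%:Z%R) -> positive_degrees w.
Proof.
move=> amp; split=> [I Im|J Jm].
- pose s0 : {set ray Y} := inr @: I.
  have s0Y : s0 \in cones Y.
    apply/cone_YmnP; rewrite (_ : xco s0 = setT); last first.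
      by apply/setP => j; rewrite !inE; apply/imsetP => -[].
    rewrite (_ : yset s0 = I) ?Im ?cardsT ?card_ord; last first.
      by apply/setP => i; rewrite inE mem_imset //; apply: inr_inj.
    by split; [exact: subsetT | | left; lia].
  have [s smax s0s] := @maxset_exists _ (fun t => t \in cones Y) s0 s0Y.
  have sY := maxsetp smax; have [mu muP] := amp _ smax.
  have [j jI js] : exists2 j, j \in ~: (widx @: I) & inl j \notin s.
    have [k kx ky] := missing_index sY; exists k; rewrite inE in kx => //.
    rewrite inE; apply: contra ky; apply: subsetP; apply: imsetS.
    by apply/subsetP => i iI; rewrite inE (subsetP s0s) ?imset_f.
  have := sum_xgen_pairing mu; rewrite (big_split_widx _ I) /= => sum0.
  have sumI : (\sum_(i in I) (xgen (widx i) *m mu) 0 0 =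
               \sum_(i in I) (w (inr i)).+1%:Z)%R.
    apply: eq_bigr => i iI; have := muP (inr i).
    by rewrite (subsetP s0s) ?imset_f //= mulNmx mxE => /oppr_inj.
  have sumIc : (\sum_(j in ~: (widx @: I)) - (w (inl j)).+1%:Z <
               \sum_(j in ~: (widx @: I)) (xgen j *m mu) 0 0)%R.
    apply: ltr_sum_strict jI _ _.
      by have := muP (inl j); rewrite (negPf js).
    by move=> k _; have := muP (inl k); case: ifP => _ => [->|/ltW].
  move: sum0 sumIc; rewrite sumI sumrN !sumPosz => sum0.
  by rewrite -ltz_nat -(addr0_eq sum0) ltrN2.
pose s0 : {set ray Y} := inl @: (~: (widx @: J)).
have s0Y : s0 \in cones Y.
  have xE : xco s0 = widx @: J.
    by apply/setP => j; rewrite inE mem_imset ?inE ?negbK //; apply: inl_inj.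
  have yE : yset s0 = set0.
    by apply/setP => i; rewrite !inE; apply/imsetP => -[].
  apply/cone_YmnP; rewrite xE yE imset0 cards0 card_widx Jm; split=> //.
    exact: sub0set.
  by left.
have [s smax s0s] := @maxset_exists _ (fun t => t \in cones Y) s0 s0Y.
have sY := maxsetp smax; have [mu muP] := amp _ smax.
have [i iJ iy] : exists2 i, i \in J & inr i \notin s.
  have /cone_YmnP[_ ym _] := sY.
  have /subsetPn[i iJ iy] : ~~ (J \subset yset s).
    by apply: contraTN ym => /subset_leq_card; rewrite Jm -ltnNge.
  by exists i; rewrite // inE in iy.
have := sum_xgen_pairing mu; rewrite (big_split_widx _ J) /= => sum0.
have sumJc : (\sum_(j in ~: (widx @: J)) (xgen j *m mu) 0 0 =
              \sum_(j in ~: (widx @: J)) - (w (inl j)).+1%:Z)%R.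
  apply: eq_bigr => j jJ; have := muP (inl j).
  by rewrite (subsetP s0s) ?imset_f.
have sumJ : (\sum_(i in J) (xgen (widx i) *m mu) 0 0 <
             \sum_(i in J) (w (inr i)).+1%:Z)%R.
  apply: ltr_sum_strict iJ _ _.
    by have := muP (inr i); rewrite (negPf iy) /= mulNmx mxE ltrN2.
  move=> k _; have := muP (inr k); rewrite /= mulNmx mxE.
  by case: ifP => _ => [/oppr_inj ->|/ltW]; rewrite ?lerN2.
move: sum0 sumJ; rewrite sumJc sumrN !sumPosz => sum0.
by rewrite -ltz_nat (subr0_eq sum0).
Qed.

(** On a maximal cone with [y]-indices [B] and omitted index [k], the linear
    form is prescribed at all indices but [k], where sum zero imposes its
    value. The inequality at [x_k] is the first one for an [m]-subset [I]
    containing [B]; the inequality at [y_k] only arises when [|B| = m], and is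
    the second one for [B] together with [k]. *)
Lemma degrees_ample (w : ray Y -> nat) :
  positive_degrees w -> ample (F := Y) (fun r => (w r).+1%:Z%R).
Proof.
move=> [degI degJ] s smax; have [k [ky xE ym kbig]] := maximal_cone_Ymn smax.
have /cone_YmnP[disj _ _] := maxsetp smax.
set B := yset s in ky xE ym kbig disj.
have xB i : i \in B -> inl (widx i) \notin s.
  move=> iB; have := subsetP disj (widx i).
  by rewrite mem_widx => /(_ iB); rewrite inE.
have xk : inl k \notin s by have := setU11 k (widx @: B); rewrite -xE inE.
have xA j : j != k -> j \notin widx @: B -> inl j \in s.
  move=> jk jB; apply: contraT => js; have : j \in xco s by rewrite inE.
  by rewrite xE in_setU1 (negPf jk) (negPf jB).
(* the prescribed values; off the cone and away from k, the index j belongs to B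
   and the sum has a single term *)
pose g (j : idx) : int := if inl j \in s then (- (w (inl j)).+1%:Z)%R
  else (\sum_(i | widx i == j) (w (inr i)).+1%:Z)%R.
have gB i : i \in B -> g (widx i) = (w (inr i)).+1%:Z%R.
  by move=> /xB/negPf xi; rewrite /g xi (big_pred1 i).
pose h (j : idx) : int := if j == k then (- \sum_(j | j != k) g j)%R else g j.
have hk : h k = (- \sum_(j | j != k) g j)%R by rewrite /h eqxx.
have hN j : j != k -> h j = g j by rewrite /h => /negPf ->.
have sumh : (\sum_j h j = 0)%R.
  rewrite (bigD1 k) //= hk [X in (_ + X)%R](eq_bigr g) ?addNr //.
have hB i : i \in B -> h (widx i) = (w (inr i)).+1%:Z%R.
  by move=> iB; rewrite hN ?gB //; apply: contraNneq ky => <-; rewrite mem_widx.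
have hA j : inl j \in s -> h j = (- (w (inl j)).+1%:Z)%R.
  by move=> js; rewrite hN /g ?js //; apply: contraTneq js => ->.
have hkE : (h k + (\sum_(i in B) (w (inr i)).+1)%N%:Z =
    (\sum_(j in ~: (widx @: B) | j != k) (w (inl j)).+1)%N%:Z)%R.
  rewrite -sumPosz (big_morph Posz PoszD (erefl 0%Z)).
  move: sumh; rewrite (big_split_widx _ B) /= (eq_bigr _ hB).
  rewrite [X in (_ + X)%R](bigD1 k) ?inE //=.
  rewrite [X in (_ + (_ + X))%R](eq_bigr (fun j => - (w (inl j)).+1%:Z)%R).
    by rewrite sumrN addrA => /subr0_eq <-; rewrite addrC.
  by move=> j /andP[jB jk]; rewrite hA ?xA // -in_setC.
have [mu muP] := xgen_pairing sumh; exists mu => -[j|i] /=.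
  rewrite muP; case: ifP => js; first exact: hA.
  case: (eqVneq j k) => [->|jk]; last first.
    have : j \in widx @: B by apply: contraFT js; apply: xA.
    by case/imsetP => i iB ->; rewrite hB //; lia.
  have [|I [BI _ Im]] := @subset_between _ B setT m (subsetT _).
    by rewrite ym cardsT card_ord ltnW.
  have := degI I Im.
  have leB : \sum_(i in B) (w (inr i)).+1 <= \sum_(i in I) (w (inr i)).+1.
    by rewrite [leqRHS](big_setID B) /= (setIidPr BI) leq_addr.
  have leBc : \sum_(j in ~: (widx @: I)) (w (inl j)).+1 <=
              \sum_(j in ~: (widx @: B)) (w (inl j)).+1.
    rewrite [leqRHS](big_setID (~: (widx @: I))) /= (setIidPr _) ?leq_addr //.
    by rewrite setCS imsetS.
  have Bk : \sum_(j in ~: (widx @: B)) (w (inl j)).+1 =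
      (w (inl k)).+1 + \sum_(j in ~: (widx @: B) | j != k) (w (inl j)).+1.
    by rewrite (bigD1 k) // inE.
  rewrite Bk in leBc => ltI.
  have := leq_ltn_trans leB (leq_trans ltI leBc).
  rewrite -ltz_nat PoszD -hkE addrA ltrDr => k_gt0.
  by rewrite -subr_gt0 opprK addrC.
rewrite mulNmx mxE muP; case: ifP => iy; first by rewrite hB // inE.
rewrite ltrN2; case: (eqVneq (widx i) k) => [ik|ik]; last first.
  have iB : i \notin B by rewrite inE iy.
  by rewrite hA ?xA ?mem_widx //; lia.
have {}ym : #|B| = m by case: kbig => //; rewrite -ik leqNgt /= ltn_ord.
have iB : i \notin B by rewrite -mem_widx ik.
have := degJ (i |: B); rewrite cardsU1 iB ym => /(_ erefl).
rewrite big_setU1 //= imsetU1 ik.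
rewrite (eq_bigl (fun j => (j \in ~: (widx @: B)) && (j != k))); last first.
  by move=> j; rewrite !inE negb_or andbC.
by rewrite -ltz_nat -hkE PoszD ltrD2r.
Qed.

(** * Completeness and smoothness of the model *)

Section RealCoordinates.

Local Open Scope ring_scope.

Variable R : realType.

(** The coefficient of [x_j] after substituting [y_i = - x_i]. *)
Definition net (c : ray Y -> R) (j : idx) : R :=
  c (inl j) - \sum_(i | widx i == j) c (inr i).

Lemma net_widx c i : net c (widx i) = c (inl (widx i)) - c (inr i).
Proof.
by rewrite /net (big_pred1 i).
Qed.

Lemma net_high c (j : idx) : (n <= j)%N -> net c j = c (inl j).
Proof.
move=> nj; rewrite /net big_pred0 ?subr0 // => i.
by apply: contraTF nj => /eqP <-; rewrite -ltnNge /= ltn_ord.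
Qed.

Lemma rayvec_Ymn c :
  rayvec (F := Y) c = \row_l (net c (lift ord_max l) - net c ord_max).
Proof.
have indY (a : idx) :
    \sum_i c (inr i) * (a == widx i)%:R = \sum_(i | widx i == a) c (inr i).
  rewrite [RHS]big_mkcond; apply: eq_bigr => i _; rewrite eq_sym.
  by case: ifP; rewrite ?mulr1 ?mulr0.
apply/rowP => l; rewrite mxE /rayvec summxE big_sumType /=.
under eq_bigr => j _ do
  rewrite !mxE xgenE rmorphB /= !rmorph_nat mulrC mulrBl.
rewrite sumrB !(sum_indicator _ (c \o inl)) /=.
under eq_bigr => i _ do
  rewrite !mxE xgenE rmorphN rmorphB /= !rmorph_nat mulrN mulrBr.
rewrite sumrN sumrB !indY /net; lra.
Qed.

(** [x_i] and [y_i] never occur together, so an expression is recovered from the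
    positive and negative parts of its net coefficients. *)
Lemma cone_net (c : ray Y -> R) :
  (forall r, 0 <= c r) -> supp c \in cones Y ->
  (forall j, c (inl j) = Num.max (net c j) 0) /\
  (forall i, c (inr i) = Num.max (- net c (widx i)) 0).
Proof.
move=> c0 /cone_YmnP[/subsetP disj _ _].
have xy i : c (inl (widx i)) = 0 \/ c (inr i) = 0.
  case: (eqVneq (c (inr i)) 0) => ci; [by right | left].
  have := disj (widx i); rewrite mem_widx !inE ci negbK => /(_ isT).
  by move/eqP.
split=> [j|i]; last first.
  rewrite net_widx opprB; case: (xy i) => ->; rewrite ?subr0 ?sub0r.
    by rewrite max_l.
  by rewrite max_r // oppr_le0.
case: (ltnP j n) => [jn|nj]; last by rewrite net_high // max_l.
have -> : j = widx (Ordinal jn) by apply: val_inj.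
rewrite net_widx; case: (xy (Ordinal jn)) => ->; rewrite ?subr0 ?sub0r.
  by rewrite max_r // oppr_le0.
by rewrite max_l.
Qed.

(** The net coefficients of two expressions of a vector differ by a constant.
    Were it nonzero, every [x]-index missing from one support would be a
    [y]-index of the other; but the former are more than [m] in number or
    exceed [n]. *)
Lemma no_net_shift (c c' : ray Y -> R) :
  (forall r, 0 <= c r) -> (forall r, 0 <= c' r) ->
  supp c \in cones Y -> supp c' \in cones Y ->
  ~ (forall j, net c j <= 0 -> net c' j < 0).
Proof.
move=> c0 c'0 cY c'Y shift.
have [cx _] := cone_net c0 cY; have [_ c'y] := cone_net c'0 c'Y.
have sub : xco (supp c) \subset widx @: yset (supp c').
  apply/subsetP => j; rewrite !inE negbK cx => /eqP cj.
  have /shift j0 : net c j <= 0 by rewrite -cj le_max lexx.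
  have jn : (j < n)%N.
    rewrite ltnNge; apply: contraTN j0 => nj.
    by rewrite net_high // -leNgt.
  have jE : j = widx (Ordinal jn) by apply: val_inj.
  rewrite jE mem_widx !inE c'y -jE max_l ?oppr_eq0 ?lt_eqF //.
  by rewrite oppr_ge0 ltW.
have /cone_YmnP[_ _ [xm|[j nj jx]]] := cY.
  have /cone_YmnP[_ ym _] := c'Y.
  have := subset_leq_card sub; rewrite card_widx leqNgt.
  by rewrite (leq_ltn_trans ym xm).
have /imsetP[i _ jE] := subsetP sub j jx.
by move: nj; rewrite jE leqNgt /= ltn_ord.
Qed.

(** Existence: shift the coordinates [u] of a vector by the largest of their
    values [t] such that the indices with [u < t] are [y]-indices allowed in a
    cone, at most [m] and among the first [n]. By maximality the set [u <= t]
    no longer has this property, which is the remaining condition for a cone.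
    *)
Lemma cone_coordinates_Ymn : cone_coordinates R Y.
Proof.
split=> [c c' c0 c'0 cY c'Y|v].
  rewrite !rayvec_Ymn => /rowP eqv.
  pose t := net c ord_max - net c' ord_max.
  have netE j : net c j = net c' j + t.
    rewrite /t; case: (unliftP ord_max j) => [l ->|->]; last by lra.
    by have := eqv l; rewrite !mxE; lra.
  have t0 : t = 0.
    case: (ltgtP t 0) => // ht.
      case: (no_net_shift c'0 c0 c'Y cY) => j; rewrite netE; lra.
    case: (no_net_shift c0 c'0 cY c'Y) => j; rewrite netE; lra.
  have [cx cy] := cone_net c0 cY; have [c'x c'y] := cone_net c'0 c'Y.
  by case=> [j|i]; rewrite ?cx ?cy ?c'x ?c'y netE t0 addr0.
(* the coordinates of v modulo constants, normalized by 0 at the last index *)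
pose u (j : idx) : R := if unlift ord_max j is Some l then v 0 l else 0.
pose low j := [set i | u i < u j].
pose Q := [pred j | (#|low j| <= m)%N && [forall i in low j, (i < n)%N]].
have [k1 _ k1min] := @arg_minP _ _ _ (ord0 : idx) xpredT u isT.
have Qk1 : Q k1.
  have lk1 : low k1 = set0.
    by apply/setP => i; rewrite !inE ltNge k1min.
  by rewrite /= lk1 cards0; apply/forall_inP => i; rewrite inE.
have [k /= /andP[km kn] kmax] := @arg_maxP _ _ _ k1 Q u Qk1.
pose c (r : ray Y) : R := match r with
  | inl j => Num.max (u j - u k) 0
  | inr i => Num.max (u k - u (widx i)) 0 end.
have netE j : net c j = u j - u k.
  case: (ltnP j n) => [jn|nj].
    have -> : j = widx (Ordinal jn) by apply: val_inj.
    rewrite net_widx /=; case: (lerP (u (widx (Ordinal jn))) (u k)) => h.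
      by rewrite max_r ?max_l ?subr_ge0 ?subr_le0 // sub0r opprB.
    by rewrite max_l ?max_r ?subr_ge0 ?subr_le0 ?ltW // subr0.
  rewrite net_high //= max_l // subr_ge0 leNgt.
  apply: contraTN nj => uj; rewrite -ltnNge.
  by apply: (forall_inP kn); rewrite inE.
exists c; split.
- by case=> [j|i]; rewrite /= le_max lexx orbT.
- have ylow : widx @: yset (supp c) \subset low k.
    apply/subsetP => _ /imsetP[i + ->]; rewrite !inE /=; apply: contraR.
    by rewrite -leNgt => h; rewrite max_r // subr_le0.
  have xE j : (j \in xco (supp c)) = (u j <= u k).
    rewrite !inE negbK /=; case: lerP => h.
      by rewrite max_r ?eqxx // subr_le0.
    by rewrite max_l ?subr_ge0 ?ltW // subr_eq0 gt_eqF.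
  apply/cone_YmnP; split.
  + apply/subsetP => j /(subsetP ylow); rewrite xE inE; exact: ltW.
  + by rewrite -card_widx (leq_trans (subset_leq_card ylow)).
  case: (ltnP m #|xco (supp c)|) => [|xm]; [by left | right].
  have [/exists_inP //|/exists_inPn xn] :=
    boolP [exists (j : idx | (n <= j)%N), j \in xco (supp c)]; exfalso.
  have [j0 j0x] : exists j, j \in ~: xco (supp c).
    apply/set0Pn; rewrite -card_gt0 cardsCs setCK card_ord subn_gt0; lia.
  (* the next value after u k would still be admissible *)
  have [j jx jmin] := @arg_minP _ _ _ j0 [pred i | i \in ~: xco (supp c)] u j0x.
  have lowx : low j \subset xco (supp c).
    apply/subsetP => i; rewrite inE; apply: contraTT => ix.
    by rewrite -leNgt jmin //= in_setC.
  have /kmax : Q j.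
    apply/andP; split; first by rewrite (leq_trans (subset_leq_card lowx)).
    apply/forall_inP => i /(subsetP lowx) ix; rewrite ltnNge.
    by apply: contraL ix => /xn.
  by move: jx; rewrite /= in_setC xE => /negPf ->.
rewrite rayvec_Ymn; apply/rowP => l; rewrite mxE !netE.
rewrite [u ord_max]/u unlift_none /u liftK; lra.
Qed.

End RealCoordinates.

(** Leaving out an index [k] that the cone does not use, the [x_j], [j != k],
    form a basis of [N]; change the signs of those for which the cone lacks
    [x_j]. *)
Lemma unimodular_Ymn : unimodular_cones Y.
Proof.
move=> s sY; have [k kx ky] := missing_index sY.
have /cone_YmnP[/subsetP disj _ _] := sY.
rewrite inE in kx.
pose sg l : int := if inl (lift k l) \in s then 1%R else (-1)%R.
pose ix (r : ray Y) : idx := match r with inl j => j | inr i => widx i end.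
pose f (r : ray Y) : 'I_m.*2.+1 := odflt ord0 (unlift k (ix r)).
have ixk r : r \in s -> ix r != k.
  case: r => [j|i] /= rs; first by apply: contraNneq kx => <-.
  by apply: contraNneq ky => <-; rewrite mem_widx inE.
have fE r : r \in s -> lift k (f r) = ix r.
  move=> /ixk; rewrite /f; case: unliftP => [l -> //|->].
  by rewrite eqxx.
have yx i : inr i \in s -> inl (widx i) \notin s.
  by move=> iy; have := disj (widx i); rewrite mem_widx !inE => /(_ iy).
pose B : 'M[int]_m.*2.+1 := (\matrix_l (sg l *: xgen (lift k l)))%R.
(* the inverse of B; when k is not the last index, x_k is minus the sum of the
   other x_j *)
pose G : 'M[int]_m.*2.+1 :=
  (\matrix_l (if unlift k (lift ord_max l) is Some i then sg i *: delta_mx 0 i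
              else \row_i - sg i))%R.
have sg2 l : (sg l * sg l = 1)%R by rewrite /sg; case: ifP.
exists B, f; split.
- suff /mulmx1_unit[] : (G *m B = 1%:M)%R by [].
  apply/row_matrixP => l; rewrite row_mul rowK row1.
  have -> : (delta_mx 0 l = xgen (lift ord_max l))%R by rewrite /xgen liftK.
  case: unliftP => [i ->|->].
    by rewrite -scalemxAl -rowE rowK scalerA sg2 scale1r.
  rewrite mulmx_sum_row; have := sum_xgen; rewrite (bigD1_ord k) //=.
  move=> /eqP; rewrite addr_eq0 => /eqP ->; rewrite -sumrN.
  apply: eq_bigr => i _.
  by rewrite mxE rowK scalerA mulNr sg2 scaleN1r.
- move=> r r' rs r's /(congr1 (lift k)); rewrite !fE //.
  case: r r' rs r's => [j|i] [j'|i'] /= rs r's.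
  + by move=> ->.
  + by move=> jE; have := yx _ r's; rewrite -jE rs.
  + by move=> jE; have := yx _ rs; rewrite jE r's.
  + by move=> /widx_inj ->.
move=> r rs; rewrite rowK fE // /sg fE //.
case: r rs => [j|i] /= rs; first by rewrite rs scale1r.
by rewrite (negPf (yx _ rs)) scaleN1r.
Qed.

End Model.

(** * Minimal weights *)

Lemma sum_succ (I : finType) (A : {set I}) (f : I -> nat) :
  \sum_(i in A) (f i).+1 = \sum_(i in A) f i + #|A|.
Proof.
rewrite -sum1_card -big_split; apply: eq_bigr => i _ /=.
by rewrite addn1.
Qed.

Section Weights.

Variables (m n : nat) (le_n : n <= m.*2.+2).
Variables (alpha : 'I_n -> nat) (beta : 'I_m.*2.+2 -> nat).

Local Notation widx := (Defs.widx le_n).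

Definition pair_weight (i : 'I_n) : nat := alpha i + beta (widx i).

(** Adding the sum of the [beta_i] over [I], resp. [J], to both sides makes the
    conditions depend on the [alpha_i + beta_i] and on the total of [beta]
    only. *)
Lemma positive_degrees_pair :
  positive_degrees (le_n := le_n) (Yweight alpha beta) <->
  (forall I : {set 'I_n}, #|I| = m ->
     \sum_(i in I) pair_weight i <= (\sum_j beta j).+1) /\
  (forall J : {set 'I_n}, #|J| = m.+1 ->
     \sum_j beta j < \sum_(i in J) pair_weight i).
Proof.
have split (I : {set 'I_n}) : \sum_j beta j =
    \sum_(i in I) beta (widx i) + \sum_(j in ~: (widx @: I)) beta j.
  exact: (big_split_widx le_n _ I beta).
have cardC (I : {set 'I_n}) : #|~: (widx @: I)| = (m + m).+2 - #|I|.
  by rewrite cardsCs setCK card_ord card_widx addnn.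
rewrite /positive_degrees /pair_weight /=; split=> -[degI degJ]; split=> I Im.

- have := degI I Im; rewrite !sum_succ cardC Im (split I) big_split /=.
  move: (\sum_(i in I) alpha i) (\sum_(i in I) beta _)
    (\sum_(j in ~: _) beta j) => a b c; lia.
- have := degJ I Im; rewrite !sum_succ cardC Im (split I) big_split /=.
  move: (\sum_(i in I) alpha i) (\sum_(i in I) beta _)
    (\sum_(j in ~: _) beta j) => a b c; lia.
- have := degI I Im; rewrite !sum_succ cardC Im (split I) big_split /=.
  move: (\sum_(i in I) alpha i) (\sum_(i in I) beta _)
    (\sum_(j in ~: _) beta j) => a b c; lia.
- have := degJ I Im; rewrite !sum_succ cardC Im (split I) big_split /=.
  move: (\sum_(i in I) alpha i) (\sum_(i in I) beta _)
    (\sum_(j in ~: _) beta j) => a b c; lia.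
Qed.

Lemma sum_low_high :
  \sum_(j < m.*2.+2) beta j =
  \sum_(i < n) beta (widx i) + \sum_(j < m.*2.+2 | n <= j) beta j.
Proof.
rewrite (bigID (fun j : 'I__ => j < n)) (big_ord_narrow le_n) /=.
by congr (_ + _); apply: eq_bigl => j; rewrite -leqNgt.
Qed.

Lemma total_weight :
  \sum_(i < n) alpha i + \sum_(j < m.*2.+2) beta j =
  \sum_(i < n) pair_weight i + \sum_(j < m.*2.+2 | n <= j) beta j.
Proof.
by rewrite sum_low_high addnA -big_split.
Qed.

End Weights.

(** If [g i0 = 0], then adding [i0] to an [m]-set [K] does not change its sum,
    so the two bounds together determine the sum over [K]; exchanging one
    element of [K] for another shows that [g] is constant away from [i0]. The
    exchange takes place outside [i0], which needs [n] to be at least [m + 2].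
    *)
Lemma equal_weights_or_large (m n : nat) (g : 'I_n -> nat) (b : nat) :
  0 < m -> m.+2 <= n ->
  (forall I : {set 'I_n}, #|I| = m -> \sum_(i in I) g i <= b.+1) ->
  (forall J : {set 'I_n}, #|J| = m.+1 -> b < \sum_(i in J) g i) ->
  n <= \sum_i g i \/
  exists i0 e,
    [/\ 0 < e, g i0 = 0, forall i, i != i0 -> g i = e & m * e = b.+1].
Proof.
move=> m_gt0 lt_mn gI gJ.
have [/forallP gpos|/forallPn[i0]] := boolP [forall i, 0 < g i].
  left; rewrite -[leqLHS]card_ord -sum1_card; apply: leq_sum => i _.
  exact: gpos.
rewrite -eqn0Ngt => /eqP g0; right.
have tight (K : {set 'I_n}) :
    i0 \notin K -> #|K| = m -> \sum_(i in K) g i = b.+1.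
  move=> i0K Km; apply/eqP; rewrite eqn_leq gI //=.
  have := gJ (i0 |: K); rewrite cardsU1 i0K Km big_setU1 //= g0 => /(_ erefl).
  by [].
have swap i i' : i != i0 -> i' != i0 -> g i = g i'.
  move=> ii0 i'i0; case: (eqVneq i i') => [-> //|ii'].
  have [|K [_ Ksub Km]] :=
      @subset_between _ set0 (~: [set i0; i; i']) m.-1 (sub0set _).
    have S3 : #|[set i0; i; i']| <= 3.
      rewrite (leq_trans (leq_card_setU _ _)) // cards1 cards2.
      by case: (_ != _).
    by rewrite cards0 cardsCs setCK card_ord; lia.
  have KN k : k \in [set i0; i; i'] -> k \notin K.
    by move=> kin; apply/negP => /(subsetP Ksub); rewrite inE kin.
  have sumK k : k \in [set i; i'] -> k != i0 -> g k + \sum_(l in K) g l = b.+1.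
    move=> kin ki0; have kK : k \notin K.
      apply: KN; move: kin; rewrite !inE => /orP[] /eqP ->;
        by rewrite eqxx ?orbT.
    rewrite -(tight (k |: K)) ?big_setU1 //.
      by rewrite in_setU1 negb_or eq_sym ki0 KN // !inE eqxx.
    by rewrite cardsU1 kK Km; lia.
  have := sumK i; have := sumK i'; rewrite !inE !eqxx orbT.
  move=> /(_ erefl i'i0) e1.
  by move=> /(_ erefl ii0); rewrite -e1 => /addIn.
have [K [_ Ksub Km]] : exists K : {set 'I_n},
    [/\ set0 \subset K, K \subset [set~ i0] & #|K| = m].
  by apply: subset_between; rewrite ?sub0set // cards0 cardsC1 card_ord; lia.
have [i1 i1K] : exists i, i \in K by apply/set0Pn; rewrite -card_gt0 Km.
have KN i : i \in K -> i != i0 by move=> /(subsetP Ksub); rewrite !inE.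
have me : m * g i1 = b.+1.
  rewrite -(tight K) //; last by apply: contraL isT => /KN; rewrite eqxx.
  rewrite (eq_bigr (fun=> g i1)); first by rewrite sum_nat_const Km.
  by move=> i iK; apply: swap; apply: KN.
exists i0, (g i1); split=> //; last first.
  by move=> i ii0; apply: swap => //; apply: KN.
by rewrite lt0n; apply: contra_eqN me => /eqP ->; rewrite muln0.
Qed.

Lemma card_tail_indices n : #|tail_indices n| = n.-1.
Proof.
case: n => [|n].
  by apply/eqP; rewrite -leqn0 -[leqRHS](card_ord 0) max_card.
rewrite (_ : tail_indices _ = [set~ ord0]) ?cardsC1 ?card_ord //.
by apply/setP => i; rewrite !inE.
Qed.

Lemma hat_pair_weight m n (le_n : n <= m.*2.+2) (T : {set 'I_n}) i :
  T \subset tail_indices n ->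
  hat_alpha T i + hat_beta le_n T (widx le_n i) = (i \in tail_indices n).
Proof.
move=> Ttail; rewrite /hat_alpha /hat_beta mem_widx in_setD.
case: (boolP (i \in T)) => [/(subsetP Ttail) -> //|_].
by rewrite addn0.
Qed.

Lemma hat_beta_high m n (le_n : n <= m.*2.+2) (T : {set 'I_n})
    (j : 'I_m.*2.+2) :
  n <= j -> hat_beta le_n T j = 0.
Proof.
move=> nj; rewrite /hat_beta; case: imsetP => // -[i _ jE].
by move: nj; rewrite jE leqNgt /= ltn_ord.
Qed.

Lemma sum_nat_indicator (I : finType) (A B : {set I}) :
  \sum_(i in A) (i \in B : nat) = #|A :&: B|.
Proof.
rewrite -sum1_card big_mkcond [RHS]big_mkcond; apply: eq_bigr => i _.
by rewrite inE; case: (i \in A); case: (i \in B).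
Qed.

Lemma sum_tail_indices n : \sum_(i < n) (i \in tail_indices n : nat) = n.-1.
Proof.
have := sum_nat_indicator setT (tail_indices n).
by rewrite setTI card_tail_indices => <-; apply: eq_bigl => i; rewrite inE.
Qed.

(** Here [alpha_i + beta_i] is [0] at the first index and [1] at the others, and
    the total of [beta] is [m - 1]. *)
Lemma hat_degrees m n (le_n : n <= m.*2.+2) (T : {set 'I_n}) :
  0 < m -> T \subset tail_indices n -> #|T| = m.-1 ->
  positive_degrees (le_n := le_n) (Yweight (hat_alpha T) (hat_beta le_n T)).
Proof.
move=> m_gt0 Ttail Tm.
have sumb : \sum_j hat_beta le_n T j = m.-1.
  rewrite -Tm -(card_widx le_n) -[widx _ @: T]setTI -sum_nat_indicator.
  by apply: eq_bigl => j; rewrite inE.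
have sumg (I : {set 'I_n}) :
    \sum_(i in I) pair_weight le_n (hat_alpha T) (hat_beta le_n T) i =
    #|I :&: tail_indices n|.
  by rewrite -sum_nat_indicator; apply: eq_bigr => i _; apply: hat_pair_weight.
apply/positive_degrees_pair; split=> I Im; rewrite sumb sumg.
  by rewrite prednK // -Im subset_leq_card // subsetIl.
rewrite prednK //; have := cardsID (tail_indices n) I; rewrite Im.
suff : #|I :\: tail_indices n| <= 1 by lia.
apply/card_le1_eqP => i i'; rewrite !inE !negbK.
move=> /andP[/eqP i0 _] /andP[/eqP i'0 _].
by apply: val_inj; rewrite /= i0 i'0.
Qed.

Section LiftOfModel.

Variables (m n : nat) (le_n : n <= m.*2.+2).
Hypotheses (m_gt0 : 0 < m) (lt_mn : m < n).

Variables (alpha : 'I_n -> nat) (beta : 'I_m.*2.+2 -> nat) (X : fan).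
Hypothesis liftX : raywise_lift (Yweight (le_n := le_n) alpha beta) X.

Lemma Fano_raywise_lift :
  Fano X <-> positive_degrees (le_n := le_n) (Yweight alpha beta).
Proof.
case: liftX => s [us sE ->].
apply: iff_trans (Fano_lift_along _ _ _ (@face_closed_Ymn _ _ _)) _.
have wE r : \sum_(t <- s | id t == r) Yweight (le_n := le_n) alpha beta t =
    Yweight (le_n := le_n) alpha beta r.
  rewrite -big_filter; case: (boolP (r \in s)) => rs.
    by rewrite filter_pred1_uniq // big_seq1.
  rewrite big1_seq; last first.
    move=> t /=; rewrite mem_filter => /andP[/eqP ->].
    by rewrite (negPf rs).
  by move: rs; rewrite sE inE -eqn0Ngt => /eqP ->.
split=> [amp|deg].
  apply: (ample_degrees lt_mn); apply: ample_ext amp => r.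
  by rewrite wE.
apply: ample_ext (degrees_ample lt_mn deg) => r.
by rewrite wE.
Qed.

Lemma fdim_raywise_lift :
  fdim X = m.*2.+1 + (\sum_(i < n) alpha i + \sum_(j < m.*2.+2) beta j).
Proof.
case: liftX => s [us sE ->]; rewrite fdim_lift_along; congr (_ + _).
rewrite big_uniq //= addnC; set w := Yweight alpha beta.
transitivity (\sum_r w r); last by rewrite big_sumType.
rewrite big_mkcond; apply: eq_bigr => r _.
by rewrite sE inE -/w; case: (posnP (w r)).
Qed.

Lemma smooth_complete_raywise_lift (R : realType) : smooth_complete_fan R X.
Proof.
case: liftX => s [us sE ->]; apply: smooth_complete_lift_along.
- by move=> r; apply: ray_Ymn.
- exact: face_closed_Ymn.
- exact: cone_coordinates_Ymn.
- exact: unimodular_Ymn.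
Qed.

End LiftOfModel.

Theorem theorem5p12 (R : realType) (m n : nat)
    (hm : 1 <= m) (hmn : m.+2 <= n) (hn : n <= m.*2.+2) :
  (forall (alpha : 'I_n -> nat) (beta : 'I_m.*2.+2 -> nat) (X : fan),
     raywise_lift (Yweight (le_n := hn) alpha beta) X -> Fano X ->
     let W := \sum_(i < n) alpha i + \sum_(j < m.*2.+2) beta j in
     n.-1 <= W
     /\ (W = n.-1 <->
         exists (s : 'S_n) (T : {set 'I_n}),
           [/\ T \subset tail_indices n, #|T| = m.-1,
               forall i, alpha (s i) = hat_alpha T i,
               forall i, beta (widx hn (s i)) = hat_beta hn T (widx hn i)
             & forall j : 'I_m.*2.+2, n <= j -> beta j = hat_beta hn T j]))
  /\
  (forall (T : {set 'I_n}) (Yhat : fan),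
     T \subset tail_indices n -> #|T| = m.-1 ->
     raywise_lift (Yweight (le_n := hn) (hat_alpha T) (hat_beta hn T)) Yhat ->
     [/\ smooth_complete_fan R Yhat, Fano Yhat & fdim Yhat = 2 * m + n]).
Proof.
have lt_mn : m < n by apply: ltnW.
split=> [alpha beta X liftX FanoX W|T Yhat Ttail Tm liftY]; last first.
  split.
  - exact: (smooth_complete_raywise_lift hm lt_mn liftY).
  - exact/(Fano_raywise_lift lt_mn liftY)/hat_degrees.
  rewrite (fdim_raywise_lift liftY) total_weight.
  rewrite [X in _ + (_ + X)]big1 => [|j]; last exact: hat_beta_high.
  rewrite (eq_bigr (fun i => (i \in tail_indices n) : nat)); last first.
    by move=> i _; apply: hat_pair_weight.
  by rewrite sum_tail_indices; lia.
have [degI degJ] :=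
  (positive_degrees_pair hn alpha beta).1
    ((Fano_raywise_lift lt_mn liftX).1 FanoX).
have WE : W = \sum_i pair_weight hn alpha beta i +
              \sum_(j < m.*2.+2 | n <= j) beta j by exact: total_weight.
set g := pair_weight hn alpha beta in degI degJ WE.
have sumg i0 e : g i0 = 0 -> (forall i, i != i0 -> g i = e) ->
    \sum_i g i = n.-1 * e.
  move=> g0 ge; rewrite (bigD1 i0) //= g0 (eq_bigr (fun=> e)) //.
  by rewrite sum_nat_const cardC1 card_ord.
have alt := equal_weights_or_large hm hmn degI degJ.
split.
  rewrite WE; case: alt => [|[i0 [e [e_gt0 g0 ge _]]]]; first lia.
  by rewrite (sumg i0 e) //; nia.
split=> [Wn|[s [T [Ttail Tm aE bE bhigh]]]]; last first.
  rewrite WE [X in _ + X]big1 ?addn0 => [|j nj]; last first.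
    by rewrite bhigh // hat_beta_high.
  rewrite (reindex_inj (@perm_inj _ s)) /=.
  rewrite (eq_bigr (fun i => (i \in tail_indices n) : nat)); last first.
    by move=> i _; rewrite /g /pair_weight aE bE hat_pair_weight.
  exact: sum_tail_indices.
case: alt => [|[i0 [e [e_gt0 g0 ge me]]]]; first by lia.
have e1 : e = 1 by rewrite (sumg i0 e) // in WE; nia.
have high0 : \sum_(j < m.*2.+2 | n <= j) beta j = 0.
  by rewrite (sumg i0 e) // e1 in WE; lia.
have beta0 (j : 'I_m.*2.+2) : n <= j -> beta j = 0.
  move=> nj; move/eqP: high0; rewrite sum_nat_eq0 => /forall_inP/(_ j nj).
  by move/eqP.
have n_gt0 : 0 < n by lia.
(* the permutation brings the index of weight zero to the first place *)
pose o := Ordinal n_gt0; pose s := tperm i0 o.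
have gs i : alpha (s i) + beta (widx hn (s i)) = (i \in tail_indices n).
  rewrite -/(pair_weight hn alpha beta (s i)) -/g inE.
  case: (eqVneq i o) => [->|io]; first by rewrite tpermR g0.
  rewrite ge ?e1; first by rewrite -[0]/(val o) (inj_eq val_inj) io.
  by apply: contra io => /eqP si; rewrite -(tpermK i0 o i) si tpermL.
exists s, [set i | beta (widx hn (s i)) == 1].
set T := [set i | _].
have bT i : beta (widx hn (s i)) = (i \in T).
  have := gs i; rewrite !inE; case: (beta _) => [|[|k]] //.
  by case: (val i != 0) => /=; lia.
have Ttail : T \subset tail_indices n.
  apply/subsetP => i iT; have := gs i; rewrite bT iT.
  by case: (i \in _) => //; lia.
split=> //.
- have := sum_low_high hn beta; rewrite high0 addn0.
  rewrite (reindex_inj (@perm_inj _ s)) /= (eq_bigr _ (fun i _ => bT i)).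
  have := sum_nat_indicator setT T; rewrite setTI.
  under eq_bigl => i do rewrite inE.
  by move=> -> sumb; rewrite -sumb; apply: (canRL succnK); rewrite -me e1 muln1.
- move=> i; have := gs i; rewrite bT /hat_alpha in_setD.
  case: (i \in T) => /=; last by rewrite addn0.
  rewrite addn1.
  by case: (i \in tail_indices n) => // -[].
- by move=> i; rewrite bT /hat_beta mem_widx.
- by move=> j nj; rewrite beta0 // hat_beta_high.
Qed.
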